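(* For $\vec a=(0,1)$, the special cases $\lambda=\pm2$ provide parametrizations in terms of elementary functions of Riemann ZMC examples in $\mathbb{L}^3$ foliated by spacelike circles contained in parallel timelike planes, namely: (1) Case $\lambda=2$. The surface is $$X(r,v)=(\arctan r,0,r-\arctan r)+r(0,\sinh v,\cosh v),\qquad r>0,\ v\in\mathbb{R}.$$ The surface is timelike and converges to a point as $r\to0$. (2) Case $\lambda=-2$. The surface is $$X(r,v)=\left(\tfrac12\log\left|\tfrac{1-r}{r+1}\right|,0,r+\tfrac12\log\left|\tfrac{1-r}{r+1}\right|\right)+r(0,\sinh v,\cosh v),\qquad r>0,\ r\ne1,\ v\in\mathbb{R}.$$ If $0<r<1$ the surface contains regions of spacelike and of timelike points, while if $r>1$ the surface is timelike.
   Context: $\mathbb{L}^3$ is $\mathbb{R}^3$ with the metric $\langle,\rangle=dx_1^2+dx_2^2-dx_3^2$. A surface is spacelike, timelike or lightlike at a point if the induced metric there is Riemannian, Lorentzian or degenerate. The mean curvature $H$ is defined on the non-degenerate part; ZMC means $H=0$ there. A spacelike circle in a plane $x_1=\text{const}$ is a hyperbola $s\mapsto p+r(0,\sinh s,\cosh s)$, $r>0$. A Riemann ZMC example is a non-rotational surface with zero mean curvature foliated by (pieces of) circles contained in parallel planes. Such surfaces are described by $X(q,v)=(x(q),m(q)\vec a)+\sqrt q(0,\sinh v,\cosh v)$ with $q=r^2$ the squared radius, $\vec a$ a nonzero vector of the $x_2x_3$-plane, $\frac{dq}{dx}=\pm2\sqrt{-\langle\vec a,\vec a\rangle q^3+\lambda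 q^2+q}$, $\frac{dm}{dx}=q$ and $\lambda\in\mathbb{R}$; $\langle\vec a,\vec a\rangle=a_2^2-a_3^2$ for $\vec a=(a_2,a_3)$. ''Converges to a point as $r\to0$'' means $X(r,v)$ tends, for each fixed $v$, to one and the same point. *)

(* Defs.v *)
(* Stdlib reals and Coquelicot. *)
From Stdlib Require Import Reals.
From Coquelicot Require Import Coquelicot.
Open Scope R_scope.

(** * Lorentz-Minkowski space *)

Definition L3 : Type := (R * R * R)%type.

Definition x1 (p : L3) : R := fst (fst p).
Definition x2 (p : L3) : R := snd (fst p).
Definition x3 (p : L3) : R := snd p.

Definition vzero : L3 := (0, 0, 0).
Definition vadd (p q : L3) : L3 := (x1 p + x1 q, x2 p + x2 q, x3 p + x3 q).
Definition vscal (k : R) (p : L3) : L3 := (k * x1 p, k * x2 p, k * x3 p).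

Definition lor (p q : L3) : R := x1 p * x1 q + x2 p * x2 q - x3 p * x3 q.

(* The vector with lor (lcross p q) w = det (p, q, w) for every w; the sign of
   the last component differs from the Euclidean cross product. *)
Definition lcross (p q : L3) : L3 :=
  (x2 p * x3 q - x3 p * x2 q,
   x3 p * x1 q - x1 p * x3 q,
   - (x1 p * x2 q - x2 p * x1 q)).

Definition in_span (a b w : L3) : Prop :=
  exists s t : R, w = vadd (vscal s a) (vscal t b).

Definition lin_indep (a b : L3) : Prop :=
  forall s t : R, vadd (vscal s a) (vscal t b) = vzero -> s = 0 /\ t = 0.

(* The restriction of [lor] to the plane spanned by a and b is Riemannian
   (signature ++), respectively Lorentzian (signature +-).  Both force a and b
   to be linearly independent. *)
Definition riemannian_plane (a b : L3) : Prop :=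
  lin_indep a b /\ forall w, in_span a b w -> w <> vzero -> 0 < lor w w.

Definition lorentzian_plane (a b : L3) : Prop :=
  exists e f : L3, in_span a b e /\ in_span a b f /\
    lor e e = 1 /\ lor f f = -1 /\ lor e f = 0.

(** * Parametrized surfaces *)

(* A parametrized surface is a total map X used only on a domain D. *)

Definition d_u (X : R -> R -> L3) (u v : R) : L3 :=
  (Derive (fun t => x1 (X t v)) u,
   Derive (fun t => x2 (X t v)) u,
   Derive (fun t => x3 (X t v)) u).

Definition d_v (X : R -> R -> L3) (u v : R) : L3 :=
  (Derive (fun t => x1 (X u t)) v,
   Derive (fun t => x2 (X u t)) v,
   Derive (fun t => x3 (X u t)) v).

Definition open_region (D : R -> R -> Prop) : Prop :=
  open (fun p : R * R => D (fst p) (snd p)) /\ exists u v, D u v.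

(* C^infinity on D: [ex_diff_n f n] asks for continuity of f and, recursively,
   for the partial derivatives up to order n. *)
Definition smooth_on (D : R -> R -> Prop) (f : R -> R -> R) : Prop :=
  forall (n : nat) (u v : R), D u v -> ex_diff_n f n u v.

Definition smooth_surface (D : R -> R -> Prop) (X : R -> R -> L3) : Prop :=
  open_region D /\
  smooth_on D (fun u v => x1 (X u v)) /\
  smooth_on D (fun u v => x2 (X u v)) /\
  smooth_on D (fun u v => x3 (X u v)) /\
  forall u v, D u v -> lin_indep (d_u X u v) (d_v X u v).

Definition spacelike_at (X : R -> R -> L3) (u v : R) : Prop :=
  riemannian_plane (d_u X u v) (d_v X u v).

Definition timelike_at (X : R -> R -> L3) (u v : R) : Prop :=
  lorentzian_plane (d_u X u v) (d_v X u v).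

Definition unit_normal (X : R -> R -> L3) (u v : R) : L3 :=
  let n := lcross (d_u X u v) (d_v X u v) in
  vscal (/ sqrt (Rabs (lor n n))) n.

(* H = (eps/2) (l G - 2 m F + n E) / (E G - F^2), where eps = <N,N> = +-1. *)
Definition mean_curvature (X : R -> R -> L3) (u v : R) : R :=
  let N := unit_normal X u v in
  let E := lor (d_u X u v) (d_u X u v) in
  let F := lor (d_u X u v) (d_v X u v) in
  let G := lor (d_v X u v) (d_v X u v) in
  let l := lor (d_u (d_u X) u v) N in
  let m := lor (d_u (d_v X) u v) N in
  let n := lor (d_v (d_v X) u v) N in
  lor N N / 2 * ((l * G - 2 * m * F + n * E) / (E * G - F ^ 2)).

Definition ZMC (D : R -> R -> Prop) (X : R -> R -> L3) : Prop :=
  forall u v, D u v -> spacelike_at X u v \/ timelike_at X u v ->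
  mean_curvature X u v = 0.

(** * Rotational surfaces *)

Definition rigid_motion (f : L3 -> L3) : Prop :=
  exists (A : L3 -> L3) (b : L3),
    (forall p q, A (vadd p q) = vadd (A p) (A q)) /\
    (forall k p, A (vscal k p) = vscal k (A p)) /\
    (forall p q, lor (A p) (A q) = lor p q) /\
    (forall p, f p = vadd (A p) b).

(* A nontrivial one-parameter group of rigid motions fixing pointwise the
   line through c with direction d, of any causal character. *)
Definition rotation_group (c d : L3) (phi : R -> L3 -> L3) : Prop :=
  d <> vzero /\
  (forall t, rigid_motion (phi t)) /\
  (forall p, phi 0 p = p) /\
  (forall s t p, phi (s + t) p = phi s (phi t p)) /\
  (forall t p, ex_derive (fun s => x1 (phi s p)) t /\
               ex_derive (fun s => x2 (phi s p)) t /\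
               ex_derive (fun s => x3 (phi s p)) t) /\
  (exists t p, phi t p <> p) /\
  (forall t k, phi t (vadd c (vscal k d)) = vadd c (vscal k d)).

(* Invariance is only required for small t, depending on the point, so that an
   open piece of a rotation-invariant surface also counts as rotational. *)
Definition rotational (D : R -> R -> Prop) (X : R -> R -> L3) : Prop :=
  exists (c d : L3) (phi : R -> L3 -> L3), rotation_group c d phi /\
    forall u v, D u v ->
      locally 0 (fun t : R =>
        exists u' v', D u' v' /\ phi t (X u v) = X u' v').

(** * Foliations by spacelike circles *)

(* Spacelike circles of the planes x1 = const. *)
Definition spacelike_circle (C : L3 -> Prop) : Prop :=
  exists (p : L3) (r : R), 0 < r /\
    forall y, C y <-> exists s, y = vadd p (vscal r (0, sinh s, cosh s)).

(* The leaves are the coordinate curves u = const; a and b span the common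
   direction of the parallel planes. *)
Definition foliated_by_spacelike_circles_in_parallel_timelike_planes
    (D : R -> R -> Prop) (X : R -> R -> L3) : Prop :=
  exists a b : L3, lorentzian_plane a b /\
    forall u, (exists v, D u v) ->
      exists (C : L3 -> Prop) (p : L3), spacelike_circle C /\
        (forall y, C y -> exists w, in_span a b w /\ y = vadd p w) /\
        (forall y, C y <-> exists v, D u v /\ y = X u v).

(** * Riemann ZMC examples *)

(* Only the type whose leaves are spacelike circles in timelike planes; other
   Riemann ZMC examples have other circles or planes. *)
Definition riemann_ZMC_example (D : R -> R -> Prop) (X : R -> R -> L3) : Prop :=
  smooth_surface D X /\ ZMC D X /\ ~ rotational D X /\
  foliated_by_spacelike_circles_in_parallel_timelike_planes D X.

Definition lor2 (a : R * R) : R := fst a ^ 2 - snd a ^ 2.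

(* x and m are functions of q, so the derivatives with respect to x are
   dq/dx = 1 / (dx/dq) and dm/dx = (dm/dq) / (dx/dq). *)
Definition riemann_system (a : R * R) (lambda : R) (J : R -> Prop)
    (x m : R -> R) : Prop :=
  forall q, J q ->
    ex_derive x q /\ ex_derive m q /\ Derive x q <> 0 /\
    (let root := sqrt (- lor2 a * q ^ 3 + lambda * q ^ 2 + q) in
     / Derive x q = 2 * root \/ / Derive x q = - (2 * root)) /\
    Derive m q / Derive x q = q.

Definition riemann_surface (a : R * R) (x m : R -> R) (q v : R) : L3 :=
  vadd (x q, m q * fst a, m q * snd a)
       (vscal (sqrt q) (0, sinh v, cosh v)).

(* X, written in terms of the radius r = sqrt q, belongs to the family with
   parameters a and lambda; I is the set of radii. *)
Definition in_riemann_family (a : R * R) (lambda : R) (I : R -> Prop)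
    (X : R -> R -> L3) : Prop :=
  a <> (0, 0) /\
  exists x m : R -> R,
    riemann_system a lambda (fun q => 0 < q /\ I (sqrt q)) x m /\
    forall r v, 0 < r -> I r -> X r v = riemann_surface a x m (r ^ 2) v.

(* The part of a surface with radii in I and v ranging over R. *)
Definition strip (I : R -> Prop) : R -> R -> Prop := fun r _ => I r.

Definition converges_to_point_at_0 (X : R -> R -> L3) : Prop :=
  exists p : L3, forall v, filterlim (fun r => X r v) (at_right 0) (locally p).

Definition X_plus (r v : R) : L3 :=
  vadd (atan r, 0, r - atan r) (vscal r (0, sinh v, cosh v)).

Definition X_minus (r v : R) : L3 :=
  vadd (1 / 2 * ln (Rabs ((1 - r) / (r + 1))), 0,
        r + 1 / 2 * ln (Rabs ((1 - r) / (r + 1))))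
       (vscal r (0, sinh v, cosh v)).

(* Main.v *)
(* Both surfaces have the form
   X(r, v) = (f r, 0, r - e f r) + r (0, sinh v, cosh v) with f' = 1 / (r^2 + e),
   where e = 1, -1 and lambda = 2 e.  The Gram determinant of X_r, X_v is
   r^2 / (r^2 + e)^2 * (1 - (r^2 (1 + cosh v) + e)^2), which gives the causal
   character, and e^2 = 1 makes the numerator of H vanish.
   If the surface were rotational, the generator of the rotations would be an
   affine field with skew linear part, tangent to the surface.  Tangency is, for
   fixed r, a trigonometric polynomial identity in the hyperbolic angle v; it
   forces the generator to vanish, so that the rotations would be trivial. *)
Require Import Defs.
From Stdlib Require Import Reals Lra.
From Coquelicot Require Import Coquelicot.
Open Scope R_scope.

(** * Planes and their Gram determinants *)

Lemma L3_ext (p q : L3) : x1 p = x1 q -> x2 p = x2 q -> x3 p = x3 q -> p = q.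
Proof. destruct p as [[? ?] ?], q as [[? ?] ?]; cbn; congruence. Qed.

Lemma lor_comb (s t : R) (a b : L3) :
  lor (vadd (vscal s a) (vscal t b)) (vadd (vscal s a) (vscal t b)) =
  s ^ 2 * lor a a + 2 * s * t * lor a b + t ^ 2 * lor b b.
Proof. unfold lor, vadd, vscal; cbn; ring. Qed.

(** Completing the square: with E, F, G the Gram entries, G (s^2 E + 2 s t F + t^2 G) = (t G + s
    F)^2 + s^2 (E G - F^2), and the right side is positive unless s = t = 0. *)
Lemma riemannian_plane_gram (a b : L3) :
  0 < lor b b -> 0 < lor a a * lor b b - lor a b ^ 2 -> riemannian_plane a b.
Proof.
intros HG HD.
assert (pos : forall s t, s <> 0 \/ t <> 0 ->
  0 < s ^ 2 * lor a a + 2 * s * t * lor a b + t ^ 2 * lor b b).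
{ intros s t Hst.
  apply Rmult_lt_reg_l with (lor b b); [exact HG|]; rewrite Rmult_0_r.
  replace (lor b b * (s ^ 2 * lor a a + 2 * s * t * lor a b + t ^ 2 * lor b b))
    with (Rsqr (t * lor b b + s * lor a b)
          + Rsqr s * (lor a a * lor b b - lor a b ^ 2)) by (unfold Rsqr; ring).
  destruct (Req_dec s 0) as [-> | Hs].
  - replace (t * lor b b + 0 * lor a b) with (t * lor b b) by ring.
    assert (0 < Rsqr (t * lor b b)); [|unfold Rsqr in *; lra].
    apply Rlt_0_sqr, Rmult_integral_contrapositive; split; [tauto | lra].
  - assert (H := Rle_0_sqr (t * lor b b + s * lor a b)).
    assert (H' := Rmult_lt_0_compat _ _ (Rlt_0_sqr s Hs) HD); lra. }
split.
- intros s t H0.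
  assert (Hst : ~ (s <> 0 \/ t <> 0)).
  { intros Hst; assert (H := pos s t Hst); rewrite <- lor_comb, H0 in H.
    unfold lor, vzero in H; cbn in H; lra. }
  destruct (Req_dec s 0), (Req_dec t 0); tauto.
- intros w [s [t ->]] Hw; rewrite lor_comb; apply pos.
  destruct (Req_dec s 0) as [Hs | Hs]; [destruct (Req_dec t 0) as [Ht | Ht]|]; auto.
  exfalso; rewrite Hs, Ht in Hw; apply Hw; apply L3_ext; cbn; ring.
Qed.

(** Gram-Schmidt: one basis vector is b normalized, the other is the component of a orthogonal to b,
    normalized. The latter has squared norm [- k] before scaling, and the sign of the Gram
    determinant makes [k] positive. *)
Lemma lorentzian_plane_gram (a b : L3) :
  0 < lor b b -> lor a a * lor b b - lor a b ^ 2 < 0 -> lorentzian_plane a b.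
Proof.
intros HG HD.
set (k := lor a b ^ 2 / lor b b - lor a a).
assert (Hk : 0 < k).
{ unfold k; apply Rmult_lt_reg_l with (lor b b); [exact HG|].
  replace (lor b b * (lor a b ^ 2 / lor b b - lor a a))
    with (- (lor a a * lor b b - lor a b ^ 2)) by (field; lra); lra. }
assert (sG := sqrt_lt_R0 _ HG); assert (sk := sqrt_lt_R0 _ Hk).
assert (eG := sqrt_sqrt _ (Rlt_le _ _ HG)); assert (ek := sqrt_sqrt _ (Rlt_le _ _ Hk)).
exists (vadd (vscal 0 a) (vscal (/ sqrt (lor b b)) b)),
  (vadd (vscal (/ sqrt k) a) (vscal (- (lor a b / lor b b) / sqrt k) b)).
split; [eexists; eexists; reflexivity|].
split; [eexists; eexists; reflexivity|].
assert (Eab : lor a a = lor a b ^ 2 / lor b b - k) by (unfold k; ring).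
set (g := sqrt (lor b b)) in *; set (m := sqrt k) in *; clearbody g m k.
rewrite !lor_comb; split; [|split].
- rewrite <- eG; field; lra.
- rewrite Eab, <- ek; field; lra.
- transitivity (/ g / m * (lor a b - lor a b / lor b b * lor b b)); [|field; lra].
  (* Hiding this quotient keeps [lor b b] out of the denominators when [lor] is expanded into
     coordinates. *)
  generalize (lor a b / lor b b); intros c.
  unfold lor, vadd, vscal; cbn; field; lra.
Qed.

(** * Smooth functions of two variables *)

(* C^n on D, with the partial derivatives given as witnesses rather than through
   [Derive], so that closure under the operations needs no extensionality. *)
Fixpoint diff_on (D : R -> R -> Prop) (n : nat) (F : R -> R -> R) : Prop :=
  (forall u v, D u v -> continuity_2d_pt F u v) /\
  match n with
  | O => True
  | S n => exists Fu Fv : R -> R -> R,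
      (forall u v, D u v -> is_derive (fun t => F t v) u (Fu u v) /\
                            is_derive (fun t => F u t) v (Fv u v)) /\
      diff_on D n Fu /\ diff_on D n Fv
  end.

(** The derivatives of products and inverses contain the functions themselves, which are therefore
    needed at the lower order too. *)
Lemma diff_on_pred D n F : diff_on D (S n) F -> diff_on D n F.
Proof.
revert F; induction n as [|n IH]; intros F [HF [Fu [Fv [Hd [Hu Hv]]]]].
- split; [exact HF | exact I].
- split; [exact HF|]; exists Fu, Fv; auto.
Qed.

Lemma diff_on_continuity D n F u v : diff_on D n F -> D u v -> continuity_2d_pt F u v.
Proof. destruct n; intros [H _]; auto. Qed.

Lemma is_derive_Rconst (c x : R) : is_derive (fun _ : R => c) x 0.
Proof. apply (is_derive_const (V := R_NormedModule)). Qed.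

Lemma diff_on_const D n c : diff_on D n (fun _ _ => c).
Proof.
revert c; induction n as [|n IH]; intros c; (split; [intros; apply continuity_2d_pt_const|]).
- exact I.
- exists (fun _ _ => 0), (fun _ _ => 0); split; [|auto].
  intros; split; apply is_derive_Rconst.
Qed.

Lemma diff_on_plus D n F G :
  diff_on D n F -> diff_on D n G -> diff_on D n (fun u v => F u v + G u v).
Proof.
revert F G; induction n as [|n IH]; intros F G HF HG;
  (split; [intros; apply continuity_2d_pt_plus; eapply diff_on_continuity; eauto|]).
- exact I.
- destruct HF as [_ [Fu [Fv [HF [HFu HFv]]]]], HG as [_ [Gu [Gv [HG [HGu HGv]]]]].
  exists (fun u v => Fu u v + Gu u v), (fun u v => Fv u v + Gv u v); split; [|auto].
  intros u v Duv; destruct (HF u v Duv), (HG u v Duv).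
  split; apply (is_derive_plus (V := R_NormedModule)); assumption.
Qed.

Lemma is_derive_Rmult (f g : R -> R) (x df dg : R) :
  is_derive f x df -> is_derive g x dg ->
  is_derive (fun t => f t * g t) x (df * g x + f x * dg).
Proof. intros Hf Hg; apply (is_derive_mult f g x df dg Hf Hg Rmult_comm). Qed.

Lemma diff_on_mult D n F G :
  diff_on D n F -> diff_on D n G -> diff_on D n (fun u v => F u v * G u v).
Proof.
revert F G; induction n as [|n IH]; intros F G HF HG;
  (split; [intros; apply continuity_2d_pt_mult; eapply diff_on_continuity; eauto|]).
- exact I.
- assert (HF' := diff_on_pred _ _ _ HF); assert (HG' := diff_on_pred _ _ _ HG).
  destruct HF as [_ [Fu [Fv [HF [HFu HFv]]]]], HG as [_ [Gu [Gv [HG [HGu HGv]]]]].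
  exists (fun u v => Fu u v * G u v + F u v * Gu u v),
    (fun u v => Fv u v * G u v + F u v * Gv u v); split.
  + intros u v Duv; destruct (HF u v Duv), (HG u v Duv).
    split.
    * apply (is_derive_Rmult (fun t => F t v) (fun t => G t v)); assumption.
    * apply (is_derive_Rmult (fun t => F u t) (fun t => G u t)); assumption.
  + split; apply diff_on_plus; apply IH; assumption.
Qed.

Lemma diff_on_inv D n F :
  (forall u v, D u v -> F u v <> 0) -> diff_on D n F -> diff_on D n (fun u v => / F u v).
Proof.
intros F0; induction n as [|n IH]; intros HF;
  (split; [intros; apply continuity_2d_pt_inv; [eapply diff_on_continuity; eauto | auto]|]).
- exact I.
- assert (HI := IH (diff_on_pred _ _ _ HF)).
  destruct HF as [_ [Fu [Fv [HF [HFu HFv]]]]].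
  (* Written as a product of inverses rather than a quotient by a square, so that the induction
     hypothesis for [/ F u v] and closure under products apply. *)
  exists (fun u v => -1 * Fu u v * (/ F u v * / F u v)),
    (fun u v => -1 * Fv u v * (/ F u v * / F u v)); split.
  + intros u v Duv; destruct (HF u v Duv) as [H1 H2]; assert (H0 := F0 u v Duv); split.
    * replace (-1 * _ * _) with (- Fu u v / F u v ^ 2) by (field; exact H0).
      apply (is_derive_inv (fun t => F t v)); assumption.
    * replace (-1 * _ * _) with (- Fv u v / F u v ^ 2) by (field; exact H0).
      apply (is_derive_inv (fun t => F u t)); assumption.
  + split; repeat apply diff_on_mult; auto using diff_on_const.
Qed.

Lemma diff_on_fst D n : diff_on D n (fun u _ => u).
Proof.
destruct n; (split; [intros; apply continuity_2d_pt_id1|]).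
- exact I.
- exists (fun _ _ => 1), (fun _ _ => 0); split; [|split; apply diff_on_const].
  intros u v _; split; [apply (is_derive_id (K := R_AbsRing)) | apply is_derive_Rconst].
Qed.

(** Proved jointly because each function is the derivative of the other. *)
Lemma diff_on_sinh_cosh D n :
  diff_on D n (fun _ v => sinh v) /\ diff_on D n (fun _ v => cosh v).
Proof.
assert (cs : forall u v, continuity_2d_pt (fun _ v => sinh v) u v).
{ intros u v; apply (continuity_1d_2d_pt_comp sinh (fun _ v => v));
    [apply derivable_continuous_pt, derivable_pt_sinh | apply continuity_2d_pt_id2]. }
assert (cc : forall u v, continuity_2d_pt (fun _ v => cosh v) u v).
{ intros u v; apply (continuity_1d_2d_pt_comp cosh (fun _ v => v));
    [apply derivable_continuous_pt, derivable_pt_cosh | apply continuity_2d_pt_id2]. }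
induction n as [|n [IHs IHc]].
- split; (split; [auto | exact I]).
- split; (split; [auto|]); exists (fun _ _ => 0).
  + exists (fun _ v => cosh v); split; [|auto using diff_on_const].
    intros u v _; split; [apply is_derive_Rconst |].
    apply is_derive_Reals, derivable_pt_lim_sinh.
  + exists (fun _ v => sinh v); split; [|auto using diff_on_const].
    intros u v _; split; [apply is_derive_Rconst |].
    apply is_derive_Reals, derivable_pt_lim_cosh.
Qed.

(** This gives smoothness of a profile function from its rational derivative alone, uniformly for
    the arctangent and the logarithm. *)
Lemma diff_on_primitive D n (f : R -> R) (g : R -> R -> R) :
  (forall u v, D u v -> is_derive f u (g u v)) -> diff_on D n g ->
  diff_on D (S n) (fun u _ => f u).
Proof.
intros Hf Hg; split.
- intros u v Duv; apply (continuity_1d_2d_pt_comp f (fun u _ => u));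
    [|apply continuity_2d_pt_id1].
  apply continuity_pt_filterlim, (ex_derive_continuous f); eexists; eapply Hf, Duv.
- exists g, (fun _ _ => 0); split; [|auto using diff_on_const].
  intros u v Duv; split; [apply Hf, Duv | apply is_derive_Rconst].
Qed.

(** The witnesses agree with [Derive] at all points of D, hence near each of them since D is open,
    and [ex_diff_n] depends only on local values. *)
Lemma diff_on_ex_diff_n D n F :
  open (fun p : R * R => D (fst p) (snd p)) -> diff_on D n F ->
  forall u v, D u v -> ex_diff_n F n u v.
Proof.
intros oD; revert F; induction n as [|n IH]; intros F HF u v Duv;
  (split; [eapply diff_on_continuity; eauto|]).
- exact I.
- destruct HF as [_ [Fu [Fv [HF [HFu HFv]]]]].
  destruct (HF u v Duv) as [H1 H2].
  assert (lD : locally_2d D u v)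
    by (apply locally_2d_locally, (oD (u, v)), Duv).
  split; [eexists; apply H1|]; split; [eexists; apply H2|]; split.
  + apply ex_diff_n_ext_loc with Fu; [|auto].
    revert lD; apply locally_2d_impl, locally_2d_forall; intros u' v' D'.
    symmetry; apply is_derive_unique, (HF u' v' D').
  + apply ex_diff_n_ext_loc with Fv; [|auto].
    revert lD; apply locally_2d_impl, locally_2d_forall; intros u' v' D'.
    symmetry; apply is_derive_unique, (HF u' v' D').
Qed.

(** * Differential geometry of the surfaces *)

Definition surf (f h : R -> R) (r v : R) : L3 :=
  vadd (f r, 0, h r) (vscal r (0, sinh v, cosh v)).

(** The data shared by both surfaces: the sign e and an open nonempty set I of radii that avoids the
    pole of f', which is r = 1 when e = -1. *)
Definition profile (e : R) (I : R -> Prop) (f h : R -> R) : Prop :=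
  e ^ 2 = 1 /\ open I /\ (exists r, I r) /\
  forall r, I r -> 0 < r /\ r ^ 2 + e <> 0 /\
    is_derive f r (/ (r ^ 2 + e)) /\ h r = r - e * f r.

Lemma profile_locally e I f h r : profile e I f h -> I r -> locally r I.
Proof. intros [_ [oI _]]; apply oI. Qed.

Lemma profile_derive_h e I f h r : profile e I f h -> I r -> is_derive h r (r ^ 2 / (r ^ 2 + e)).
Proof.
intros P Ir; assert (lI := profile_locally e I f h r P Ir).
destruct P as [_ [_ [_ H]]].
apply is_derive_ext_loc with (fun t => t - e * f t).
- apply filter_imp with (2 := lI); intros t It; symmetry; apply H, It.
- destruct (H r Ir) as [_ [w0 [Hf _]]].
  replace (r ^ 2 / (r ^ 2 + e)) with (1 - e * / (r ^ 2 + e)) by (field; exact w0).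
  apply (is_derive_minus (V := R_NormedModule)).
  + apply (is_derive_id (K := R_AbsRing)).
  + apply is_derive_scal, Hf.
Qed.

Lemma d_u_surf e I f h u v : profile e I f h -> I u ->
  d_u (surf f h) u v = (/ (u ^ 2 + e), sinh v, u ^ 2 / (u ^ 2 + e) + cosh v).
Proof.
intros P Iu; assert (Hh := profile_derive_h e I f h u P Iu).
destruct P as [_ [_ [_ H]]]; destruct (H u Iu) as [_ [_ [Hf _]]].
apply L3_ext; cbn [x1 x2 x3 fst snd d_u d_v surf vadd vscal]; apply is_derive_unique.
- auto_derive; [eexists; apply Hf | 
    replace (Derive _ _) with (/ (u ^ 2 + e)) by (symmetry; apply is_derive_unique, Hf); ring].
- auto_derive; [trivial | ring].
- auto_derive; [eexists; apply Hh | 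
    replace (Derive _ _) with (u ^ 2 / (u ^ 2 + e)) by (symmetry; apply is_derive_unique, Hh); ring].
Qed.

Lemma is_derive_sinh v : is_derive sinh v (cosh v).
Proof. apply is_derive_Reals, derivable_pt_lim_sinh. Qed.

Lemma is_derive_cosh v : is_derive cosh v (sinh v).
Proof. apply is_derive_Reals, derivable_pt_lim_cosh. Qed.

Lemma d_v_surf f h u v : d_v (surf f h) u v = (0, u * cosh v, u * sinh v).
Proof.
apply L3_ext; cbn [x1 x2 x3 fst snd d_u d_v surf vadd vscal]; apply is_derive_unique.
- auto_derive; [trivial | ring].
- auto_derive; [eexists; apply is_derive_sinh |].
  replace (Derive _ _) with (cosh v) by (symmetry; apply is_derive_unique, is_derive_sinh); ring.
- auto_derive; [eexists; apply is_derive_cosh |].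
  replace (Derive _ _) with (sinh v) by (symmetry; apply is_derive_unique, is_derive_cosh); ring.
Qed.

(** The first derivative is known only for radii in I, so it is differentiated on a neighbourhood
    contained in I. *)
Lemma d_uu_surf e I f h u v : profile e I f h -> I u ->
  d_u (d_u (surf f h)) u v =
  (- (2 * u) / (u ^ 2 + e) ^ 2, 0, 2 * e * u / (u ^ 2 + e) ^ 2).
Proof.
intros P Iu; assert (lI := profile_locally e I f h u P Iu).
assert (w0 : u ^ 2 + e <> 0) by (destruct P as [_ [_ [_ H]]]; apply H, Iu).
apply L3_ext; unfold d_u at 1; cbn [x1 x2 x3 fst snd]; apply is_derive_unique.
- apply is_derive_ext_loc with (fun t => / (t ^ 2 + e)).
  + apply filter_imp with (2 := lI); intros t It; rewrite (d_u_surf e I f h t v P It); reflexivity.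
  + auto_derive; [exact w0 | field; exact w0].
- apply is_derive_ext_loc with (fun t => sinh v).
  + apply filter_imp with (2 := lI); intros t It; rewrite (d_u_surf e I f h t v P It); reflexivity.
  + apply is_derive_Rconst.
- apply is_derive_ext_loc with (fun t => t ^ 2 / (t ^ 2 + e) + cosh v).
  + apply filter_imp with (2 := lI); intros t It; rewrite (d_u_surf e I f h t v P It); reflexivity.
  + auto_derive; [exact w0 | field; exact w0].
Qed.

Lemma d_uv_surf f h u v : d_u (d_v (surf f h)) u v = (0, cosh v, sinh v).
Proof.
apply L3_ext; unfold d_u; cbn [x1 x2 x3 fst snd]; apply is_derive_unique.
- apply is_derive_ext with (fun t => 0); [|apply is_derive_Rconst].
  intros t; rewrite d_v_surf; reflexivity.
- apply is_derive_ext with (fun t => t * cosh v).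
  + intros t; rewrite d_v_surf; reflexivity.
  + auto_derive; [trivial | ring].
- apply is_derive_ext with (fun t => t * sinh v).
  + intros t; rewrite d_v_surf; reflexivity.
  + auto_derive; [trivial | ring].
Qed.

Lemma d_vv_surf f h u v : d_v (d_v (surf f h)) u v = (0, u * sinh v, u * cosh v).
Proof.
apply L3_ext; unfold d_v at 1; cbn [x1 x2 x3 fst snd]; apply is_derive_unique.
- apply is_derive_ext with (fun t => 0); [|apply is_derive_Rconst].
  intros t; rewrite d_v_surf; reflexivity.
- apply is_derive_ext with (fun t => u * cosh t).
  + intros t; rewrite d_v_surf; reflexivity.
  + apply is_derive_scal, is_derive_cosh.
- apply is_derive_ext with (fun t => u * sinh t).
  + intros t; rewrite d_v_surf; reflexivity.
  + apply is_derive_scal, is_derive_sinh.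
Qed.

Lemma cosh_sqr v : cosh v ^ 2 = 1 + sinh v ^ 2.
Proof.
unfold cosh, sinh; assert (H : exp v * exp (- v) = 1).
{ rewrite <- exp_plus, Rplus_opp_r; apply exp_0. }
nra.
Qed.

(** * First fundamental form and causal character *)

Lemma gram_surf e I f h u v : profile e I f h -> I u ->
  let a := d_u (surf f h) u v in let b := d_v (surf f h) u v in
  lor b b = u ^ 2 /\
  lor a a * lor b b - lor a b ^ 2 =
  u ^ 2 / (u ^ 2 + e) ^ 2 * (1 - (u ^ 2 * (1 + cosh v) + e) ^ 2).
Proof.
intros P Iu; cbv zeta; rewrite (d_u_surf e I f h u v P Iu), d_v_surf.
assert (w0 : u ^ 2 + e <> 0) by (destruct P as [_ [_ [_ H]]]; apply H, Iu).
assert (cs := cosh_sqr v).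
unfold lor; cbn [x1 x2 x3 fst snd].
assert (Hb : 0 * 0 + u * cosh v * (u * cosh v) - u * sinh v * (u * sinh v) = u ^ 2).
{ transitivity (u ^ 2 * (cosh v ^ 2 - sinh v ^ 2)); [ring | rewrite cs; ring]. }
split; [exact Hb|]; rewrite Hb.
(* With A = 1 / (u^2 + e) and B = u^2 A, eliminating sinh v turns the bracket into A^2 - (1 + B cosh
   v)^2. *)
transitivity (u ^ 2 * ((/ (u ^ 2 + e)) ^ 2 + sinh v ^ 2
  - (u ^ 2 / (u ^ 2 + e) + cosh v) ^ 2 - (u ^ 2 / (u ^ 2 + e)) ^ 2 * sinh v ^ 2)).
- ring.
- replace (sinh v ^ 2) with (cosh v ^ 2 - 1) by lra; field; exact w0.
Qed.

Lemma spacelike_at_surf e I f h u v : profile e I f h -> I u ->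
  (u ^ 2 * (1 + cosh v) + e) ^ 2 < 1 -> spacelike_at (surf f h) u v.
Proof.
intros P Iu H; destruct (gram_surf e I f h u v P Iu) as [HG HD].
destruct P as [_ [_ [_ P]]]; destruct (P u Iu) as [u0 [w0 _]].
apply riemannian_plane_gram; rewrite ?HD, ?HG.
- apply pow_lt, u0.
- apply Rmult_lt_0_compat; [|lra].
  apply Rdiv_lt_0_compat; [apply pow_lt, u0 | rewrite <- Rsqr_pow2; apply Rlt_0_sqr, w0].
Qed.

Lemma timelike_at_surf e I f h u v : profile e I f h -> I u ->
  1 < (u ^ 2 * (1 + cosh v) + e) ^ 2 -> timelike_at (surf f h) u v.
Proof.
intros P Iu H; destruct (gram_surf e I f h u v P Iu) as [HG HD].
destruct P as [_ [_ [_ P]]]; destruct (P u Iu) as [u0 [w0 _]].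
apply lorentzian_plane_gram; rewrite ?HD, ?HG.
- apply pow_lt, u0.
- assert (0 < u ^ 2 / (u ^ 2 + e) ^ 2).
  { apply Rdiv_lt_0_compat; [apply pow_lt, u0 | rewrite <- Rsqr_pow2; apply Rlt_0_sqr, w0]. }
  assert (0 < u ^ 2 / (u ^ 2 + e) ^ 2 * ((u ^ 2 * (1 + cosh v) + e) ^ 2 - 1));
    [apply Rmult_lt_0_compat|]; lra.
Qed.

(** * Vanishing of the mean curvature *)

Lemma lor_vscal_r k p q : lor p (vscal k q) = k * lor p q.
Proof. unfold lor, vscal; cbn; ring. Qed.

Lemma ZMC_surf e I f h : profile e I f h -> ZMC (strip I) (surf f h).
Proof.
intros P u v Iu _; unfold strip in Iu.
unfold mean_curvature, unit_normal; cbv zeta; rewrite !lor_vscal_r.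
rewrite d_vv_surf, d_uv_surf, (d_uu_surf e I f h u v P Iu).
rewrite (d_u_surf e I f h u v P Iu), d_v_surf.
assert (w0 : u ^ 2 + e <> 0) by (destruct P as [_ [_ [_ H]]]; apply H, Iu).
destruct P as [e2 _].
(* The normalizing factor [k] of the normal is common to the three second-order coefficients, so the
   numerator may be computed with the unnormalized normal. *)
match goal with |- _ * ((?k * ?l * ?G - 2 * (?k * ?m) * ?F + ?k * ?n * ?E) / _) = 0 =>
  assert (H : l * G - 2 * m * F + n * E = 0);
  [|replace (k * l * G - 2 * (k * m) * F + k * n * E) with
     (k * (l * G - 2 * m * F + n * E)) by ring; rewrite H; unfold Rdiv; ring]
end.
assert (cs := cosh_sqr v).
set (s := sinh v) in *; set (c := cosh v) in *.
set (A := / (u ^ 2 + e)); set (B := u ^ 2 / (u ^ 2 + e)).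
assert (Hn : lcross (A, s, B + c) (0, u * c, u * s) = (- (u * (1 + B * c)), - (A * u * s), - (A * u * c))).
{ apply L3_ext; unfold lcross; cbn [x1 x2 x3 fst snd]; [|ring|ring].
  transitivity (- (u * (c ^ 2 - s ^ 2 + B * c))); [ring | rewrite cs; ring]. }
rewrite Hn; clear Hn.
assert (HG : lor (0, u * c, u * s) (0, u * c, u * s) = u ^ 2).
{ unfold lor; cbn [x1 x2 x3 fst snd].
  transitivity (u ^ 2 * (c ^ 2 - s ^ 2)); [ring | rewrite cs; ring]. }
assert (HE : lor (A, s, B + c) (A, s, B + c) = A ^ 2 - 1 - B ^ 2 - 2 * B * c).
{ unfold lor; cbn [x1 x2 x3 fst snd].
  transitivity (A ^ 2 - (c ^ 2 - s ^ 2) - B ^ 2 - 2 * B * c); [ring | rewrite cs; ring]. }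
assert (Hm : lor (0, c, s) (- (u * (1 + B * c)), - (A * u * s), - (A * u * c)) = 0)
  by (unfold lor; cbn [x1 x2 x3 fst snd]; ring).
assert (Hnn : lor (0, u * s, u * c) (- (u * (1 + B * c)), - (A * u * s), - (A * u * c))
  = A * u ^ 2).
{ unfold lor; cbn [x1 x2 x3 fst snd].
  transitivity (A * u ^ 2 * (c ^ 2 - s ^ 2)); [ring | rewrite cs; ring]. }
rewrite HG, HE, Hm, Hnn; unfold lor; cbn [x1 x2 x3 fst snd].
(* The terms in cosh v cancel because B = u^2 A and A (u^2 + e) = 1. *)
transitivity (- (e ^ 2 - 1) * u ^ 2 * A ^ 3); [unfold A, B; field; exact w0 | rewrite e2; ring].
Qed.

(** * Regularity, foliation and membership in the Riemann family *)

Lemma smooth_surf e I f h : profile e I f h -> smooth_surface (strip I) (surf f h).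
Proof.
intros P; assert (P' := P); destruct P' as [_ [oI [[r0 Ir0] H]]].
assert (oD : open (fun p : R * R => strip I (fst p) (snd p))).
{ apply (open_comp fst I); [|exact oI].
  intros [u v] _; apply continuous_fst. }
assert (w0 : forall u v, strip I u v -> u ^ 2 + e <> 0) by (intros u v Iu; apply H, Iu).
assert (dw : forall n, diff_on (strip I) n (fun u _ => / (u ^ 2 + e))).
{ intros n; apply (diff_on_inv _ _ (fun u _ => u ^ 2 + e)); [exact w0|].
  apply (diff_on_plus _ _ (fun u _ => u ^ 2) (fun _ _ => e)); [|apply diff_on_const].
  (* [u ^ 2] computes to [u * (u * 1)]. *)
  apply (diff_on_mult _ _ (fun u _ => u) (fun u _ => u * 1)); [apply diff_on_fst|].
  apply (diff_on_mult _ _ (fun u _ => u) (fun _ _ => 1));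
    [apply diff_on_fst | apply diff_on_const]. }
assert (df : forall n, diff_on (strip I) n (fun u _ => f u)).
{ intros n; apply diff_on_pred.
  apply diff_on_primitive with (fun u _ => / (u ^ 2 + e)); [|apply dw].
  intros u v Iu; apply H, Iu. }
assert (dh : forall n, diff_on (strip I) n (fun u _ => h u)).
{ intros n; apply diff_on_pred.
  apply diff_on_primitive with (fun u _ => 1 + - e * / (u ^ 2 + e)).
  - intros u v Iu; replace (1 + - e * / (u ^ 2 + e)) with (u ^ 2 / (u ^ 2 + e))
      by (field; apply (w0 u v Iu)).
    apply (profile_derive_h e I f h u P Iu).
  - apply diff_on_plus; [|apply diff_on_mult]; auto using diff_on_const. }
split; [|split; [|split; [|split]]].
- split; [exact oD | exists r0, 0; exact Ir0].
- intros n; apply diff_on_ex_diff_n; [exact oD|]; cbn [x1 fst surf vadd vscal].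
  apply (diff_on_plus _ _ (fun u _ => f u)); [apply df|].
  apply (diff_on_mult _ _ (fun u _ => u) (fun _ _ => 0));
    [apply diff_on_fst | apply diff_on_const].
- intros n; apply diff_on_ex_diff_n; [exact oD|]; cbn [x2 fst snd surf vadd vscal].
  apply (diff_on_plus _ _ (fun _ _ => 0)); [apply diff_on_const|].
  apply (diff_on_mult _ _ (fun u _ => u)); [apply diff_on_fst | apply diff_on_sinh_cosh].
- intros n; apply diff_on_ex_diff_n; [exact oD|]; cbn [x3 snd surf vadd vscal].
  apply (diff_on_plus _ _ (fun u _ => h u)); [apply dh|].
  apply (diff_on_mult _ _ (fun u _ => u)); [apply diff_on_fst | apply diff_on_sinh_cosh].
(* Independence: the first coordinate of the r-derivative is nonzero and that of the v-derivative is
   zero, so s = 0; then u cosh v > 0 gives t = 0. *)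
- intros u v Iu s t; unfold strip in Iu.
  rewrite (d_u_surf e I f h u v P Iu), d_v_surf; intros E.
  destruct (H u Iu) as [u0 [w1 _]].
  assert (E1 := f_equal x1 E); assert (E2 := f_equal x2 E); clear E.
  unfold vadd, vscal, vzero in E1, E2; cbn [x1 x2 x3 fst snd] in E1, E2.
  assert (s0 : s = 0).
  { replace s with ((s * / (u ^ 2 + e) + t * 0) * (u ^ 2 + e)) by (field; exact w1).
    rewrite E1; ring. }
  split; [exact s0|]; rewrite s0 in E2.
  assert (c0 : 0 < u * cosh v).
  { apply Rmult_lt_0_compat; [exact u0|]; unfold cosh.
    assert (A := exp_pos v); assert (B := exp_pos (- v)); lra. }
  destruct (Rmult_integral t (u * cosh v)); [lra | assumption | lra].
Qed.

Lemma foliated_surf e I f h : profile e I f h ->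
  foliated_by_spacelike_circles_in_parallel_timelike_planes (strip I) (surf f h).
Proof.
intros [_ [_ [_ H]]]; exists (0, 1, 0), (0, 0, 1); split.
- exists (0, 1, 0), (0, 0, 1); repeat split.
  + exists 1, 0; apply L3_ext; cbn; ring.
  + exists 0, 1; apply L3_ext; cbn; ring.
  + unfold lor; cbn; ring.
  + unfold lor; cbn; ring.
  + unfold lor; cbn; ring.
- intros u [v0 Iu]; destruct (H u Iu) as [u0 _].
  exists (fun y => exists v, strip I u v /\ y = surf f h u v), (f u, 0, h u).
  split; [|split].
  + exists (f u, 0, h u), u; split; [exact u0|]; intros y; split.
    * intros [v [_ ->]]; exists v; reflexivity.
    * intros [v ->]; exists v; split; [exact Iu | reflexivity].
  + intros y [v [_ ->]]; exists (vscal u (0, sinh v, cosh v)); split; [|reflexivity].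
    exists (u * sinh v), (u * cosh v); apply L3_ext; cbn; ring.
  + intros y; reflexivity.
Qed.

(** For lambda = 2 e the radicand q^3 + 2 e q^2 + q is q (q + e)^2, so the root is sqrt q |q + e|
    and the system has elementary solutions. The sign of q + e selects the branch of dq/dx. *)
Lemma in_riemann_family_surf e I f h :
  profile e I f h -> in_riemann_family (0, 1) (2 * e) I (surf f h).
Proof.
intros P; assert (P' := P); destruct P' as [e2 [_ [_ H]]].
split; [intros E; injection E; lra|].
exists (fun q => f (sqrt q)), (fun q => h (sqrt q)); split.
- intros q [q0 Iq]; destruct (H _ Iq) as [u0 [w0 [Hf _]]].
  assert (Hh := profile_derive_h e I f h _ P Iq).
  assert (qq : sqrt q ^ 2 = q) by (apply pow2_sqrt; lra).
  rewrite qq in w0, Hf, Hh.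
  assert (Hs : is_derive sqrt q (/ (2 * sqrt q)))
    by apply is_derive_Reals, derivable_pt_lim_sqrt, q0.
  assert (Dx : is_derive (fun q : R => f (sqrt q)) q (/ (2 * sqrt q) * / (q + e)))
    by apply (is_derive_comp f sqrt q _ _ Hf Hs).
  assert (Dm : is_derive (fun q : R => h (sqrt q)) q (/ (2 * sqrt q) * (q / (q + e))))
    by apply (is_derive_comp h sqrt q _ _ Hh Hs).
  split; [eexists; apply Dx|]; split; [eexists; apply Dm|].
  rewrite (is_derive_unique _ _ _ Dx), (is_derive_unique _ _ _ Dm); cbv zeta.
  assert (root : sqrt (- lor2 (0, 1) * q ^ 3 + 2 * e * q ^ 2 + q) = sqrt q * Rabs (q + e)).
  { unfold lor2; cbn [fst snd].
    replace (- (0 ^ 2 - 1 ^ 2) * q ^ 3 + 2 * e * q ^ 2 + q) with (q * Rsqr (q + e)).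
    - rewrite sqrt_mult, sqrt_Rsqr_abs; [reflexivity | lra | apply Rle_0_sqr].
    - transitivity (q ^ 3 + 2 * e * q ^ 2 + q * e ^ 2); [unfold Rsqr; ring | rewrite e2; ring]. }
  rewrite root.
  split; [|split].
  + apply Rmult_integral_contrapositive; split; apply Rinv_neq_0_compat; lra.
  + unfold Rabs; destruct (Rcase_abs (q + e)); [right | left]; field; lra.
  + field; split; lra.
- intros r v r0 Ir; unfold riemann_surface.
  rewrite sqrt_pow2 by lra; cbn [fst snd].
  unfold surf; f_equal; apply L3_ext; cbn; ring.
Qed.

(** * Rotational surfaces *)

Lemma is_derive_Rplus (f g : R -> R) (x df dg : R) :
  is_derive f x df -> is_derive g x dg -> is_derive (fun t => f t + g t) x (df + dg).
Proof. apply (is_derive_plus (V := R_NormedModule)). Qed.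

Lemma is_derive_Rminus (f g : R -> R) (x df dg : R) :
  is_derive f x df -> is_derive g x dg -> is_derive (fun t => f t - g t) x (df - dg).
Proof. apply (is_derive_minus (V := R_NormedModule)). Qed.

(** * Rigid motions and their infinitesimal generators *)

Definition vsub (p q : L3) : L3 := vadd p (vscal (-1) q).

Definition e1 : L3 := (1, 0, 0).
Definition e2 : L3 := (0, 1, 0).
Definition e3 : L3 := (0, 0, 1).

(** The linear map whose matrix has columns w1, w2, w3, applied to p. *)
Definition comb (w1 w2 w3 p : L3) : L3 :=
  vadd (vscal (x1 p) w1) (vadd (vscal (x2 p) w2) (vscal (x3 p) w3)).

(** The linear part is g p - g 0. Expressing it through values of g, not through an existential
    witness, allows differentiation along a flow. *)
Lemma rigid_motion_affine g p : rigid_motion g ->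
  vsub (g p) (g vzero) =
  comb (vsub (g e1) (g vzero)) (vsub (g e2) (g vzero)) (vsub (g e3) (g vzero)) p.
Proof.
intros [A [b [Aadd [Ascal [_ Hg]]]]].
assert (A0 : A vzero = vzero).
{ replace vzero with (vscal 0 vzero) at 1 by (apply L3_ext; cbn; ring).
  rewrite Ascal; apply L3_ext; cbn; ring. }
assert (lin : forall q, vsub (g q) (g vzero) = A q).
{ intros q; rewrite !Hg, A0; apply L3_ext; cbn; ring. }
rewrite !lin; unfold comb; rewrite <- !Ascal, <- !Aadd; f_equal.
apply L3_ext; cbn; ring.
Qed.

Lemma rigid_motion_lor g p q : rigid_motion g ->
  lor (vsub (g p) (g vzero)) (vsub (g q) (g vzero)) = lor p q.
Proof.
intros [A [b [Aadd [Ascal [Alor Hg]]]]].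
assert (A0 : A vzero = vzero).
{ replace vzero with (vscal 0 vzero) at 1 by (apply L3_ext; cbn; ring).
  rewrite Ascal; apply L3_ext; cbn; ring. }
assert (lin : forall q, vsub (g q) (g vzero) = A q).
{ intros q'; rewrite !Hg, A0; apply L3_ext; cbn; ring. }
rewrite !lin; apply Alor.
Qed.

Definition is_vderive (c : R -> L3) (t : R) (k : L3) : Prop :=
  is_derive (fun s => x1 (c s)) t (x1 k) /\ is_derive (fun s => x2 (c s)) t (x2 k) /\
  is_derive (fun s => x3 (c s)) t (x3 k).

Lemma is_vderive_unique c t k k' : is_vderive c t k -> is_vderive c t k' -> k = k'.
Proof.
intros [H1 [H2 H3]] [H1' [H2' H3']]; apply L3_ext.
- rewrite <- (is_derive_unique _ _ _ H1); apply is_derive_unique, H1'.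
- rewrite <- (is_derive_unique _ _ _ H2); apply is_derive_unique, H2'.
- rewrite <- (is_derive_unique _ _ _ H3); apply is_derive_unique, H3'.
Qed.

Lemma is_vderive_ext c c' t k : (forall s, c s = c' s) -> is_vderive c t k -> is_vderive c' t k.
Proof.
intros E [H1 [H2 H3]]; split; [|split]; eapply is_derive_ext; try eassumption;
  intros s; cbn; rewrite E; reflexivity.
Qed.

Lemma is_vderive_vadd c c' t k k' :
  is_vderive c t k -> is_vderive c' t k' ->
  is_vderive (fun s => vadd (c s) (c' s)) t (vadd k k').
Proof.
intros [H1 [H2 H3]] [H1' [H2' H3']]; unfold is_vderive; cbn;
  split; [|split]; apply is_derive_Rplus; assumption.
Qed.

Lemma is_vderive_vscal a c t k :
  is_vderive c t k -> is_vderive (fun s => vscal a (c s)) t (vscal a k).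
Proof.
intros [H1 [H2 H3]]; unfold is_vderive; cbn;
  split; [|split]; apply is_derive_scal; assumption.
Qed.

Lemma is_derive_lor c c' t k k' :
  is_vderive c t k -> is_vderive c' t k' ->
  is_derive (fun s => lor (c s) (c' s)) t (lor k (c' t) + lor (c t) k').
Proof.
intros [H1 [H2 H3]] [H1' [H2' H3']]; unfold lor.
assert (G1 := is_derive_Rmult _ _ _ _ _ H1 H1').
assert (G2 := is_derive_Rmult _ _ _ _ _ H2 H2').
assert (G3 := is_derive_Rmult _ _ _ _ _ H3 H3').
assert (G := is_derive_Rminus _ _ _ _ _ (is_derive_Rplus _ _ _ _ _ G1 G2) G3).
evar_last; [exact G | cbv beta; ring].
Qed.

(** Differentiating the affine identity at t = 0 shows that K is affine; differentiating the
    preservation of [lor] shows that its linear part is skew for [lor]. Testing skewness on pairs of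
    basis vectors leaves the three entries a, b, c. *)
Lemma flow_generator (phi : R -> L3 -> L3) (K : L3 -> L3) :
  (forall t, rigid_motion (phi t)) -> (forall p, phi 0 p = p) ->
  (forall p, is_vderive (fun t => phi t p) 0 (K p)) ->
  exists a b c w1 w2 w3, forall p, K p =
    (- a * x2 p + b * x3 p + w1, a * x1 p + c * x3 p + w2, b * x1 p + c * x2 p + w3).
Proof.
intros rig phi0 HK.
assert (HM : forall p, is_vderive (fun t => vsub (phi t p) (phi t vzero)) 0
                         (vsub (K p) (K vzero)))
  by (intros p; apply is_vderive_vadd, is_vderive_vscal; apply HK).
assert (aff : forall p, vsub (K p) (K vzero) =
  comb (vsub (K e1) (K vzero)) (vsub (K e2) (K vzero)) (vsub (K e3) (K vzero)) p).
{ intros p; apply (is_vderive_unique _ _ _ _ (HM p)).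
  apply is_vderive_ext with (fun t => comb (vsub (phi t e1) (phi t vzero))
    (vsub (phi t e2) (phi t vzero)) (vsub (phi t e3) (phi t vzero)) p).
  - intros s; symmetry; apply rigid_motion_affine, rig.
  - unfold comb; repeat apply is_vderive_vadd; apply is_vderive_vscal; apply HM. }
assert (skew : forall p q,
  lor (vsub (K p) (K vzero)) q + lor p (vsub (K q) (K vzero)) = 0).
{ intros p q.
  assert (G := is_derive_lor _ _ _ _ _ (HM p) (HM q)); cbv beta in G.
  rewrite !phi0 in G.
  replace (vsub p vzero) with p in G by (apply L3_ext; cbn; ring).
  replace (vsub q vzero) with q in G by (apply L3_ext; cbn; ring).
  rewrite <- (is_derive_unique _ _ _ G); apply is_derive_unique.
  apply is_derive_ext with (fun _ => lor p q); [|apply is_derive_Rconst].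
  intros t; symmetry; apply rigid_motion_lor, rig. }
assert (S11 := skew e1 e1); assert (S22 := skew e2 e2); assert (S33 := skew e3 e3).
assert (S12 := skew e1 e2); assert (S13 := skew e1 e3); assert (S23 := skew e2 e3).
clear skew HM HK rig phi0 phi.
set (M1 := vsub (K e1) (K vzero)) in *; set (M2 := vsub (K e2) (K vzero)) in *.
set (M3 := vsub (K e3) (K vzero)) in *.
unfold lor, e1, e2, e3 in *; cbn [x1 x2 x3 fst snd] in *.
exists (x2 M1), (x3 M1), (x3 M2), (x1 (K vzero)), (x2 (K vzero)), (x3 (K vzero)).
intros p; assert (E := aff p).
assert (E1 := f_equal x1 E); assert (E2 := f_equal x2 E); assert (E3 := f_equal x3 E).
unfold comb, vsub, vadd, vscal in E1, E2, E3; cbn [x1 x2 x3 fst snd] in E1, E2, E3.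
clearbody M1 M2 M3; clear E aff.
assert (Z1 : x1 M1 = 0) by lra; assert (Z2 : x2 M2 = 0) by lra.
assert (Z3 : x3 M3 = 0) by lra; assert (Z4 : x1 M2 = - x2 M1) by lra.
assert (Z5 : x1 M3 = x3 M1) by lra; assert (Z6 : x2 M3 = x3 M2) by lra.
rewrite Z1, Z4, Z5 in E1; rewrite Z2, Z6 in E2; rewrite Z3 in E3.
apply L3_ext; cbn [x1 x2 x3 fst snd]; lra.
Qed.

(** By the group law the velocity of an orbit at time s is the generator at the point [phi s p],
    hence zero, so every coordinate is constant along orbits. *)
Lemma flow_trivial (phi : R -> L3 -> L3) :
  (forall p, phi 0 p = p) -> (forall s t p, phi (s + t) p = phi s (phi t p)) ->
  (forall p, is_vderive (fun t => phi t p) 0 vzero) -> forall t p, phi t p = p.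
Proof.
intros phi0 phiD H t p.
assert (C : forall F : L3 -> R, (forall q, is_derive (fun s => F (phi s q)) 0 0) ->
  F (phi t p) = F p).
{ intros F HF.
  assert (D : forall s, is_derive (fun s => F (phi s p)) s 0).
  { intros s; apply is_derive_ext with (fun t => F (phi (t - s) (phi s p))).
    - intros t'; rewrite <- phiD; do 2 f_equal; ring.
    - replace 0 with (1 * 0) by ring.
      apply (is_derive_comp (fun t => F (phi t (phi s p))) (fun t => t - s)).
      + rewrite Rminus_diag_eq by reflexivity; apply HF.
      + auto_derive; [trivial | ring]. }
  rewrite <- (phi0 p) at 2; symmetry.
  destruct (Rtotal_order 0 t) as [Ht | [<- | Ht]]; [| reflexivity | symmetry].
  - apply (eq_is_derive (fun s => F (phi s p))); [intros; apply D | exact Ht].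
  - apply (eq_is_derive (fun s => F (phi s p))); [intros; apply D | exact Ht]. }
apply L3_ext; apply C; intros q; apply (H q).
Qed.

(* On the surface, [r] is the rational function [(s^2 - x2^2) / (2 s)] of the point,
   with [s = x3 + e x1 = r (1 + cosh v)].  Hence the surface lies in the level set
   [x1 = f r], to which an invariant flow must be tangent. *)
Lemma surf_tangency e I f h (c : R -> L3) (k : L3) r v :
  profile e I f h -> I r -> c 0 = surf f h r v -> is_vderive c 0 k ->
  locally 0 (fun t => exists u' v', strip I u' v' /\ c t = surf f h u' v') ->
  (r ^ 2 * (1 + cosh v) + e) * x1 k + sinh v * x2 k - cosh v * x3 k = 0.
Proof.
intros P Ir c0 [k1 [k2 k3]] inv.
assert (H := P); destruct H as [_ [_ [_ H]]].
destruct (H r Ir) as [r0 [w0 [Hf Hh]]].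
assert (cs := cosh_sqr v).
assert (cpos : forall v, 0 < 1 + cosh v).
{ intros v'; unfold cosh; assert (A := exp_pos v'); assert (B := exp_pos (- v')); lra. }
assert (key : forall u v, I u -> let p := surf f h u v in
  x3 p + e * x1 p = u * (1 + cosh v) /\
  ((x3 p + e * x1 p) ^ 2 - x2 p ^ 2) / (2 * (x3 p + e * x1 p)) = u /\ x1 p = f u).
{ intros u' v' Iu p; unfold p, surf, vadd, vscal; cbn [x1 x2 x3 fst snd].
  destruct (H u' Iu) as [u0 [_ [_ ->]]].
  assert (E : u' - e * f u' + u' * cosh v' + e * (f u' + u' * 0) = u' * (1 + cosh v')) by ring.
  rewrite E; split; [reflexivity | split; [|ring]].
  assert (cs' := cosh_sqr v'); assert (cp := cpos v').
  transitivity (u' ^ 2 * (1 + 2 * cosh v' + (cosh v' ^ 2 - sinh v' ^ 2))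
    / (2 * (u' * (1 + cosh v')))); [field; split; lra|].
  rewrite cs'; field; split; lra. }
destruct (key r v Ir) as [sE [RE fE]]; rewrite <- c0 in sE, RE, fE.
assert (cp := cpos v).
assert (s0 : 0 < x3 (c 0) + e * x1 (c 0)) by (rewrite sE; apply Rmult_lt_0_compat; lra).
set (S := fun t => x3 (c t) + e * x1 (c t)).
assert (DS : is_derive S 0 (x3 k + e * x1 k)).
{ apply is_derive_Rplus; [exact k3 | apply is_derive_scal, k1]. }
(* [Q t] is the radius of the leaf through [c t] whenever that point lies on the surface. *)
set (Q := fun t => (S t * S t - x2 (c t) * x2 (c t)) * / (2 * S t)).
assert (S0 : S 0 = r * (1 + cosh v)) by exact sE.
assert (Y0 : x2 (c 0) = r * sinh v) by (rewrite c0; cbn; ring).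
assert (DQ : is_derive Q 0 ((cosh v * (x3 k + e * x1 k) - sinh v * x2 k) / (1 + cosh v))).
{ evar_last.
  - apply is_derive_Rmult.
    + apply is_derive_Rminus; apply is_derive_Rmult; [exact DS | exact DS | exact k2 | exact k2].
    + apply is_derive_inv; [apply is_derive_scal, DS | unfold S; lra].
  - cbv beta; rewrite S0, Y0.
    replace (r * (1 + cosh v) * (r * (1 + cosh v)) - r * sinh v * (r * sinh v))
      with (r * (2 * (r * (1 + cosh v)))).
    + field; lra.
    + transitivity (r ^ 2 * (1 + 2 * cosh v + cosh v ^ 2 - sinh v ^ 2)); [|ring].
      rewrite cs; ring. }
assert (Q0 : Q 0 = r) by (rewrite <- RE; unfold Q, S; field; lra).
rewrite <- Q0 in Hf.
assert (DfQ := is_derive_comp f Q 0 _ _ Hf DQ); rewrite Q0 in DfQ.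
(* By invariance [x1 (c t) = f (Q t)] for t near 0; the two sides have equal derivatives at 0. *)
assert (E : x1 k = (cosh v * (x3 k + e * x1 k) - sinh v * x2 k) / (1 + cosh v) * / (r ^ 2 + e)).
{ transitivity (Derive (fun t => x1 (c t)) 0); [symmetry; apply is_derive_unique, k1|].
  apply is_derive_unique, is_derive_ext_loc with (2 := DfQ).
  revert inv; apply filter_imp; intros t [u' [v' [Iu Ct]]].
  destruct (key u' v' Iu) as [sE' [RE' fE']]; rewrite <- Ct in sE', RE', fE'.
  rewrite fE'; f_equal; rewrite <- RE'; unfold Q, S, Rdiv; ring. }
assert (E' : x1 k * ((r ^ 2 + e) * (1 + cosh v))
  = cosh v * (x3 k + e * x1 k) - sinh v * x2 k).
{ rewrite E at 1; field; lra. }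
lra.
Qed.

(** The substitution v = ln x turns the tangency condition into a Laurent polynomial in x, which can
    be evaluated at rational points. *)
Lemma cosh_sinh_ln x : 0 < x ->
  cosh (ln x) = (x + / x) / 2 /\ sinh (ln x) = (x - / x) / 2.
Proof.
intros x0; unfold cosh, sinh.
replace (- ln x) with (ln (/ x)) by (apply ln_Rinv, x0).
rewrite !exp_ln; auto using Rinv_0_lt_compat.
Qed.

Lemma not_rotational_surf e I f h : profile e I f h -> ~ rotational (strip I) (surf f h).
Proof.
intros P [ax [d [phi [[_ [rig [phi0 [phiD [Hdiff [[t0 [p0 nontriv]] _]]]]]] inv]]]].
apply nontriv, flow_trivial; auto.
set (K := fun p => (Derive (fun s => x1 (phi s p)) 0, Derive (fun s => x2 (phi s p)) 0,
  Derive (fun s => x3 (phi s p)) 0)).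
assert (HK : forall p, is_vderive (fun t => phi t p) 0 (K p)).
{ intros p; destruct (Hdiff 0 p) as [H1 [H2 H3]].
  split; [|split]; apply Derive_correct; assumption. }
destruct (flow_generator phi K rig phi0 HK) as [a [b [c [w1 [w2 [w3 EK]]]]]].
assert (tang : forall r x, I r -> 0 < x ->
  let C := (x + / x) / 2 in let S := (x - / x) / 2 in
  (r ^ 2 * (1 + C) + e) * (- a * (r * S) + b * (h r + r * C) + w1)
  + S * (a * f r + c * (h r + r * C) + w2) - C * (b * f r + c * (r * S) + w3) = 0).
{ intros r x Ir x0 C S; destruct (cosh_sinh_ln x x0) as [EC ES].
  assert (T := surf_tangency e I f h (fun t => phi t (surf f h r (ln x))) _ r (ln x)
    P Ir (phi0 _) (HK _) (inv r (ln x) Ir)).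
  rewrite EK, EC, ES in T; unfold surf, vadd, vscal in T; cbn [x1 x2 x3 fst snd] in T.
  rewrite EC, ES in T; fold C S in T; lra. }
assert (coef : forall r, I r -> a = 0 /\ b = 0 /\ w1 = 0 /\ w3 = 0 /\ c * h r + w2 = 0).
{ intros r Ir; destruct P as [_ [_ [_ H]]]; destruct (H r Ir) as [r0 [w0 [_ Eh]]].
  (* Only exponents from -2 to 2 occur, so five points determine all coefficients. Those of S C and
     C^2 are - a r^3 and b r^3; once a = b = 0, the constant term is w1 (r^2 + e). *)
  assert (T1 := tang r 1 Ir ltac:(lra)); assert (T2 := tang r 2 Ir ltac:(lra)).
  assert (T3 := tang r (/ 2) Ir ltac:(lra)); assert (T4 := tang r 3 Ir ltac:(lra)).
  assert (T5 := tang r (/ 3) Ir ltac:(lra)); cbv zeta in *.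
  rewrite Rinv_inv in T3, T5.
  clear tang inv HK EK Hdiff.
  assert (r3 : r ^ 3 <> 0) by (apply pow_nonzero; lra).
  assert (r2 : r ^ 2 <> 0) by (apply pow_nonzero; lra).
  assert (Ea : a * r ^ 3 = 0) by lra.
  assert (a0 : a = 0) by (destruct (Rmult_integral _ _ Ea); tauto).
  subst a.
  assert (Eb : b * r ^ 3 = 0) by lra.
  assert (b0 : b = 0) by (destruct (Rmult_integral _ _ Eb); tauto).
  subst b.
  assert (Ew : w1 * (r ^ 2 + e) = 0) by lra.
  assert (w10 : w1 = 0) by (destruct (Rmult_integral _ _ Ew); tauto).
  subst w1; repeat split; lra. }
assert (H := P); destruct H as [_ [_ [[r Ir] H]]].
destruct (coef r Ir) as [a0 [b0 [w10 [w30 _]]]].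
(* [c * h r + w2] vanishes on the open set I, while h has nonzero derivative r^2 / (r^2 + e)
   there. *)
assert (c0 : c = 0).
{ destruct (H r Ir) as [r0 [w0 _]].
  assert (Dh := profile_derive_h e I f h r P Ir).
  assert (D : is_derive (fun t => c * h t + w2) r (c * (r ^ 2 / (r ^ 2 + e)) + 0))
    by (apply is_derive_Rplus; [apply is_derive_scal, Dh | apply is_derive_Rconst]).
  assert (D0 : is_derive (fun t => c * h t + w2) r 0).
  { apply is_derive_ext_loc with (fun _ => 0); [|apply is_derive_Rconst].
    apply filter_imp with (2 := profile_locally e I f h r P Ir).
    intros t It; symmetry; apply coef, It. }
  assert (E := is_derive_unique _ _ _ D).
  rewrite (is_derive_unique _ _ _ D0) in E.
  assert (r2 : r ^ 2 <> 0) by (apply pow_nonzero; lra).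
  replace c with (c * (r ^ 2 / (r ^ 2 + e)) * ((r ^ 2 + e) / r ^ 2)) by (field; lra).
  replace (c * (r ^ 2 / (r ^ 2 + e))) with 0 by lra; ring. }
assert (w20 : w2 = 0) by (destruct (coef r Ir) as [_ [_ [_ [_ E]]]]; rewrite c0 in E; lra).
intros p; replace vzero with (K p); [apply HK|].
rewrite EK, a0, b0, c0, w10, w20, w30; apply L3_ext; cbn; ring.
Qed.

Lemma riemann_ZMC_example_surf e I f h :
  profile e I f h -> riemann_ZMC_example (strip I) (surf f h).
Proof.
intros P; split; [|split; [|split]].
- exact (smooth_surf e I f h P).
- exact (ZMC_surf e I f h P).
- exact (not_rotational_surf e I f h P).
- exact (foliated_surf e I f h P).
Qed.

(** * The two profiles *)

Lemma cosh_ge_1 v : 1 <= cosh v.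
Proof.
assert (cs := cosh_sqr v).
assert (cpos : 0 < cosh v).
{ unfold cosh; assert (A := exp_pos v); assert (B := exp_pos (- v)); lra. }
assert (S := pow2_ge_0 (sinh v)); nra.
Qed.

Lemma profile_atan : profile 1 (fun r => 0 < r) atan (fun r => r - atan r).
Proof.
split; [ring|]; split; [apply open_gt|]; split; [exists 1; lra|].
intros r r0; assert (r2 := pow2_ge_0 r); split; [exact r0|]; split; [lra|]; split; [|ring].
replace (r ^ 2 + 1) with (1 + r²) by (unfold Rsqr; ring).
apply is_derive_atan.
Qed.

(** The set I is left open as a parameter to serve for both components of the domain and for their
    union. *)
Lemma profile_ln (I : R -> Prop) :
  open I -> (exists r, I r) -> (forall r, I r -> 0 < r /\ r <> 1) ->
  profile (-1) I (fun r => 1 / 2 * ln (Rabs ((1 - r) / (r + 1))))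
    (fun r => r + 1 / 2 * ln (Rabs ((1 - r) / (r + 1)))).
Proof.
intros oI nI HI; split; [ring|]; split; [exact oI|]; split; [exact nI|].
intros r Ir; destruct (HI r Ir) as [r0 r1]; split; [exact r0|].
assert (w0 : r ^ 2 + -1 <> 0).
{ replace (r ^ 2 + -1) with ((r - 1) * (r + 1)) by ring.
  apply Rmult_integral_contrapositive; lra. }
split; [exact w0|]; split; [|ring].
assert (q0 : (1 - r) / (r + 1) <> 0).
{ apply Rmult_integral_contrapositive; split; [lra | apply Rinv_neq_0_compat; lra]. }
assert (ap := Rabs_pos_lt _ q0).
auto_derive.
- repeat split; [lra | exact q0 | exact ap].
- change ((1 + - r) * / (r + 1)) with ((1 - r) / (r + 1)).
  (* The absolute value leaves the logarithmic derivative unchanged, on either side of r = 1. *)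
  assert (sq : sign ((1 - r) / (r + 1)) * / Rabs ((1 - r) / (r + 1)) = / ((1 - r) / (r + 1))).
  { destruct (Rdichotomy _ _ q0) as [q1 | q1].
    - rewrite (sign_eq_m1 _ q1), (Rabs_left _ q1), Rinv_opp; ring.
    - rewrite (sign_eq_1 _ q1), (Rabs_right _ (Rgt_ge _ _ q1)); ring. }
  rewrite Rmult_assoc, sq; field; repeat split; lra.
Qed.

(** * Causal regions and the limit at r = 0 *)

Lemma open_box a b (J : R -> Prop) : a < b -> open J -> (exists v, J v) ->
  open_region (fun r v => a < r < b /\ J v).
Proof.
intros ab oJ [v Jv]; split; [|exists ((a + b) / 2), v; split; [lra | exact Jv]].
apply open_and.
- apply (open_comp fst (fun r => a < r < b)).
  + intros [x y] _; apply continuous_fst.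
  + apply open_and; [apply open_gt | apply open_lt].
- apply (open_comp snd J); [|exact oJ].
  intros [x y] _; apply continuous_snd.
Qed.

(** For e = -1 the causal type changes where r^2 (1 + cosh v) = 2; at r = 1/2 this means cosh v =
    7. *)
Lemma cosh_lt_7 v : -1 < v < 1 -> cosh v < 7.
Proof.
intros Hv; unfold cosh.
assert (e3 := exp_le_3).
assert (A := exp_increasing v 1 ltac:(lra)); assert (B := exp_increasing (- v) 1 ltac:(lra)).
lra.
Qed.

Lemma cosh_gt_7 v : 14 < v -> 7 < cosh v.
Proof.
intros Hv; unfold cosh; assert (A := exp_ineq1_le v); assert (B := exp_pos (- v)); lra.
Qed.

(** For each v the coordinates are continuous in r at 0 and vanish there, so the common limit is the
    origin. *)
Lemma X_plus_converges : converges_to_point_at_0 X_plus.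
Proof.
exists (0, 0, 0); intros v.
assert (lim : forall F : R -> R, continuous F 0 -> F 0 = 0 ->
  filterlim F (at_right 0) (locally 0)).
{ intros F cF F0; rewrite <- F0 at 2.
  apply filterlim_filter_le_1 with (2 := cF), filter_le_within. }
apply filterlim_locally; intros eps; repeat apply filter_and.
- refine (proj1 (filterlim_locally _ _) (lim (fun r => x1 (X_plus r v)) _ _) eps).
  + apply (ex_derive_continuous (V := R_NormedModule)); cbn; auto_derive; trivial.
  + cbn; rewrite atan_0; ring.
- refine (proj1 (filterlim_locally _ _) (lim (fun r => x2 (X_plus r v)) _ _) eps).
  + apply (ex_derive_continuous (V := R_NormedModule)); cbn; auto_derive; trivial.
  + cbn; ring.
- refine (proj1 (filterlim_locally _ _) (lim (fun r => x3 (X_plus r v)) _ _) eps).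
  + apply (ex_derive_continuous (V := R_NormedModule)); cbn; auto_derive; trivial.
  + cbn; rewrite atan_0; ring.
Qed.

Theorem proposition4p4 :
  (in_riemann_family (0, 1) 2 (fun r => 0 < r) X_plus /\
   riemann_ZMC_example (strip (fun r => 0 < r)) X_plus /\
   (forall r v : R, 0 < r -> timelike_at X_plus r v) /\
   converges_to_point_at_0 X_plus)
  /\
  (in_riemann_family (0, 1) (-2) (fun r => 0 < r /\ r <> 1) X_minus /\
   riemann_ZMC_example (strip (fun r => 0 < r /\ r <> 1)) X_minus /\
   riemann_ZMC_example (strip (fun r => 0 < r < 1)) X_minus /\
   riemann_ZMC_example (strip (fun r => 1 < r)) X_minus /\
   (exists U : R -> R -> Prop, open_region U /\
      forall r v : R, U r v -> 0 < r < 1 /\ spacelike_at X_minus r v) /\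
   (exists U : R -> R -> Prop, open_region U /\
      forall r v : R, U r v -> 0 < r < 1 /\ timelike_at X_minus r v) /\
   (forall r v : R, 1 < r -> timelike_at X_minus r v)).
Proof.
(* Both [X_plus] and [X_minus] are instances of [surf] by unfolding, so each claim reduces to a
   profile on the right set of radii. *)
assert (Pne := profile_ln (fun r => 0 < r /\ r <> 1)
  (open_and _ _ (open_gt 0) (open_neq 1)) ltac:(exists 2; lra) (fun r Ir => Ir)).
assert (Plt := profile_ln (fun r => 0 < r < 1)
  (open_and _ _ (open_gt 0) (open_lt 1)) ltac:(exists (/ 2); lra) ltac:(intros; lra)).
assert (Pgt := profile_ln (fun r => 1 < r)
  (open_gt 1) ltac:(exists 2; lra) ltac:(intros; lra)).
split; [split; [|split; [|split]] | split; [|split; [|split; [|split; [|split; [|split]]]]]].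
- replace 2 with (2 * 1) by ring; exact (in_riemann_family_surf _ _ _ _ profile_atan).
- exact (riemann_ZMC_example_surf _ _ _ _ profile_atan).
- intros r v r0; apply (timelike_at_surf _ _ _ _ r v profile_atan r0).
  assert (c1 := cosh_ge_1 v).
  assert (0 < r ^ 2 * (1 + cosh v)) by (apply Rmult_lt_0_compat; [apply pow_lt, r0 | lra]).
  nra.
- exact X_plus_converges.
- replace (-2) with (2 * -1) by ring; exact (in_riemann_family_surf _ _ _ _ Pne).
- exact (riemann_ZMC_example_surf _ _ _ _ Pne).
- exact (riemann_ZMC_example_surf _ _ _ _ Plt).
- exact (riemann_ZMC_example_surf _ _ _ _ Pgt).
(* With e = -1, spacelike points are those with 0 < r^2 (1 + cosh v) < 2; here r^2 < 1/4 and 1 +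
   cosh v < 8. *)
- exists (fun r v => 0 < r < / 2 /\ -1 < v < 1); split.
  + apply (open_box _ _ (fun v => -1 < v < 1)); [lra | | exists 0; lra].
    apply open_and; [apply open_gt | apply open_lt].
  + intros r v [Hr Hv]; split; [lra|].
    apply (spacelike_at_surf _ _ _ _ r v Plt); [lra|].
    assert (c7 := cosh_lt_7 v Hv); assert (c1 := cosh_ge_1 v).
    assert (0 < r ^ 2 < / 4) by nra.
    assert (0 < r ^ 2 * (1 + cosh v) < 2) by nra.
    nra.
(* Here r^2 > 1/4 and 1 + cosh v > 8, so r^2 (1 + cosh v) exceeds 2. *)
- exists (fun r v => / 2 < r < 1 /\ 14 < v); split.
  + apply (open_box _ _ (fun v => 14 < v)); [lra | apply open_gt | exists 15; lra].
  + intros r v [Hr Hv]; split; [lra|].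
    apply (timelike_at_surf _ _ _ _ r v Plt); [lra|].
    assert (c7 := cosh_gt_7 v Hv).
    assert (/ 4 < r ^ 2) by nra.
    assert (2 < r ^ 2 * (1 + cosh v)) by nra.
    nra.
- intros r v r1; apply (timelike_at_surf _ _ _ _ r v Pgt r1).
  assert (c1 := cosh_ge_1 v).
  assert (1 < r ^ 2) by nra.
  assert (2 < r ^ 2 * (1 + cosh v)) by nra.
  nra.
Qed.
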